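(* For every positive integer $d$ there exists a constant $C_d>0$, depending only on $d$, such that the following holds. Let $\{G_n=(V_n,E_n)\}_{n=1}^{\infty}$ be a sequence of finite, simple, connected graphs, each with at least two vertices and each equipped with the uniform weight function, such that (1) $\lim_{n\to\infty}|V_n|=\infty$, and (2) $\deg(v)\le d$ for all $v\in V_n$ and all $n$. Then there exists a metric space $X$ (with at least two points) such that for all $n\geq 1$ $$\lambda(G_n,X)\le \frac{C_d}{(\log|V_n|)^2}.$$
   Context: For a finite, simple, connected graph $G=(V,E)$ with at least two vertices, let $\vec{E}=\{(x,y)\in V\times V : \{x,y\}\in E\}$. A weight function on $G$ is a symmetric function $m:V\times V\to[0,\infty)$ whose support equals $\vec{E}$. Write $m(x)=\sum_{y\in V}m(x,y)$ and $m(\emptyset)=\sum_{x\in V}m(x)$. The uniform weight function is $m(x,y)=1$ if $(x,y)\in\vec{E}$ and $m(x,y)=0$ otherwise. For a metric space $(X,d_X)$ with at least two points, the nonlinear spectral gap $\lambda(G,X)$ of the weighted graph $(G,m)$ is the reciprocal of the smallest constant $C>0$ such that for every map $f:V\to X$ $$\frac{1}{m(\emptyset)}\sum_{x,y\in V}m(x)m(y)\,d_X(f(x),f(y))^2\le C\sum_{x,y\in V}m(x,y)\,d_X(f(x),f(y))^2 .$$ *)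

(* Defs.v *)
From HB Require Import structures.
From mathcomp Require Import all_boot all_order all_algebra.
From mathcomp Require Import all_classical all_reals all_analysis.
Import Order.TTheory GRing.Theory Num.Theory.

Set Implicit Arguments.
Unset Strict Implicit.
Unset Printing Implicit Defensive.

Local Open Scope classical_set_scope.
Local Open Scope ring_scope.

Record sgraph := SGraph {
  vert :> finType;
  adj : rel vert;
  adj_sym : symmetric adj;
  adj_irr : irreflexive adj }.

Definition connected_graph (G : sgraph) : Prop :=
  forall x y : G, connect (@adj G) x y.

Definition deg (G : sgraph) (x : G) : nat := #|[pred y | adj x y]|.

Record weight (R : realType) (G : sgraph) := Weight {
  weight_fun :> G -> G -> R;
  weight_sym : forall x y, weight_fun x y = weight_fun y x;
  weight_ge0 : forall x y, 0 <= weight_fun x y;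
  weight_supp : forall x y, (weight_fun x y != 0) = adj x y }.

Section UniformWeight.
Variables (R : realType) (G : sgraph).

Definition uniform_fun (x y : G) : R := if adj x y then 1 else 0.

Fact uniform_sym x y : uniform_fun x y = uniform_fun y x.
Proof. by rewrite /uniform_fun adj_sym. Qed.

Fact uniform_ge0 x y : 0 <= uniform_fun x y.
Proof. by rewrite /uniform_fun; case: ifP. Qed.

Fact uniform_supp x y : (uniform_fun x y != 0) = adj x y.
Proof. by rewrite /uniform_fun; case: ifP; rewrite ?oner_eq0 ?eqxx. Qed.

Definition uniform_weight : weight R G :=
  Weight uniform_sym uniform_ge0 uniform_supp.
End UniformWeight.

Section SpectralGap.
Variables (R : realType) (G : sgraph) (m : weight R G) (X : metricType R).

Definition vweight (x : G) : R := \sum_(y : G) m x y.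

Definition total_weight : R := \sum_(x : G) vweight x.

Definition mean_sqdist (f : G -> X) : R :=
  total_weight^-1 *
  \sum_(x : G) \sum_(y : G) vweight x * vweight y * mdist (f x) (f y) ^+ 2.

Definition energy (f : G -> X) : R :=
  \sum_(x : G) \sum_(y : G) m x y * mdist (f x) (f y) ^+ 2.

Definition poincare (C : R) : Prop :=
  forall f : G -> X, mean_sqdist f <= C * energy f.

(* When G is connected with at least two vertices and X has at least two
   points, this infimum is attained and positive, so it is the smallest
   admissible constant: see poincare_const_min below. *)
Definition poincare_const : R := inf [set C | 0 < C /\ poincare C].

Definition spectral_gap : R := poincare_const^-1.

Lemma vweight_ge0 x : 0 <= vweight x.
Proof. by apply: sumr_ge0 => y _; exact: weight_ge0. Qed.

Lemma total_weight_ge0 : 0 <= total_weight.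
Proof. by apply: sumr_ge0 => y _; exact: vweight_ge0. Qed.

Lemma energy_ge0 f : 0 <= energy f.
Proof.
apply: sumr_ge0 => x _; apply: sumr_ge0 => y _.
by rewrite mulr_ge0 ?weight_ge0 ?sqr_ge0.
Qed.

Lemma weight_gt0 x y : (0 < m x y) = adj x y.
Proof. by rewrite lt_neqAle weight_ge0 andbT eq_sym weight_supp. Qed.

Lemma vweight_gt0 x y : adj x y -> 0 < vweight x.
Proof.
move=> xy; rewrite /vweight (bigD1 y)//= ltr_wpDr ?weight_gt0//.
by apply: sumr_ge0 => z _; exact: weight_ge0.
Qed.

Lemma poincare_nonempty :
  connected_graph G -> [set C | 0 < C /\ poincare C] !=set0.
Proof.
move=> cG.
pose B : R := \sum_(x : G) \sum_(y : G) (m x y)^-1.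
have B_ge0 : 0 <= B.
  apply: sumr_ge0 => x _; apply: sumr_ge0 => y _.
  by rewrite invr_ge0 weight_ge0.
have Bge x y : (m x y)^-1 <= B.
  rewrite /B (bigD1 x)//= (bigD1 y)//= -addrA lerDl addr_ge0//.
    by apply: sumr_ge0 => z _; rewrite invr_ge0 weight_ge0.
  apply: sumr_ge0 => z _; apply: sumr_ge0 => t _.
  by rewrite invr_ge0 weight_ge0.
have Ege f x y : m x y * mdist (f x) (f y) ^+ 2 <= energy f.
  have t0 z t : 0 <= m z t * mdist (f z) (f t) ^+ 2.
    by rewrite mulr_ge0 ?weight_ge0 ?sqr_ge0.
  rewrite /energy (bigD1 x)//= (bigD1 y)//= -addrA lerDl addr_ge0//.
    by apply: sumr_ge0 => z _.
  by apply: sumr_ge0 => z _; apply: sumr_ge0 => t _.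
have BE f : 0 <= B * energy f by rewrite mulr_ge0 ?energy_ge0.
have edge f x y : adj x y -> mdist (f x) (f y) <= Num.sqrt (B * energy f).
  move=> xy; rewrite -(ler_pXn2r (n := 2))// ?nnegrE ?mdist_ge0 ?sqrtr_ge0//.
  rewrite sqr_sqrtr// (@le_trans _ _ ((m x y)^-1 * energy f))//.
    by rewrite ler_pdivlMl ?weight_gt0// Ege.
  by rewrite ler_wpM2r ?energy_ge0.
have walk f x p : path (@adj G) x p ->
    mdist (f x) (f (last x p)) <= (size p)%:R * Num.sqrt (B * energy f).
  elim: p x => [|y p IH] x /=; first by rewrite mdistxx mul0r.
  case/andP => xy yp; apply: (le_trans (metric_triangle _ (f y) _)).
  by rewrite -natr1 mulrDl mul1r addrC lerD ?IH ?edge.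
pose N : R := #|G|%:R.
have pair f x y : mdist (f x) (f y) ^+ 2 <= N ^+ 2 * B * energy f.
  have /connectP[p0 xp0 ->] := cG x y.
  case/shortenP: xp0 => p xp up _.
  have sp : (size p <= #|G|)%N.
    by move/card_uniqP: up => /= up; rewrite ltnW// -up max_card.
  rewrite -mulrA -[B * _]sqr_sqrtr// -exprMn lerXn2r ?nnegrE ?mdist_ge0//.
    by rewrite mulr_ge0 ?sqrtr_ge0 ?ler0n.
  apply: (le_trans (walk f x p xp)).
  by rewrite ler_wpM2r ?sqrtr_ge0// ler_nat.
pose K : R := total_weight^-1 *
  \sum_(x : G) \sum_(y : G) vweight x * vweight y * (N ^+ 2 * B).
have K_ge0 : 0 <= K.
  rewrite mulr_ge0 ?invr_ge0 ?total_weight_ge0//.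
  apply: sumr_ge0 => x _; apply: sumr_ge0 => y _.
  by rewrite !mulr_ge0 ?vweight_ge0 ?exprn_ge0 ?ler0n.
exists (K + 1); split; first by rewrite ltr_wpDl.
move=> f; rewrite mulrDl mul1r ler_wpDr ?energy_ge0//.
rewrite /mean_sqdist /K -mulrA ler_wpM2l ?invr_ge0 ?total_weight_ge0//.
rewrite mulr_suml; apply: ler_sum => x _.
rewrite mulr_suml; apply: ler_sum => y _.
by rewrite -[leRHS]mulrA ler_wpM2l ?mulr_ge0 ?vweight_ge0.
Qed.

Lemma poincare_const_min :
  connected_graph G -> (1 < #|G|)%N -> (exists a b : X, a <> b) ->
  [/\ 0 < poincare_const, poincare poincare_const &
      forall C, 0 < C -> poincare C -> poincare_const <= C].
Proof.
move=> cG cardG [a [b ab]]; set c := poincare_const.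
have ne := poincare_nonempty cG.
have lb : has_lbound [set C | 0 < C /\ poincare C].
  by exists 0 => C /= [/ltW].
have cmin C : 0 < C -> poincare C -> c <= C.
  by move=> C0 PC; apply: ge_inf.
have cge0 : 0 <= c by apply: lb_le_inf => // C [/ltW].
have cP : poincare c.
  move=> f; have [E0|E0] := eqVneq (energy f) 0.
    by have [C [_ /(_ f)]] := ne; rewrite E0 !mulr0.
  have Ep : 0 < energy f by rewrite lt_neqAle eq_sym E0 energy_ge0.
  rewrite -ler_pdivrMr//; apply: lb_le_inf => // C [_ /(_ f)].
  by rewrite -ler_pdivrMr.
split=> //; rewrite lt_neqAle cge0 andbT; apply/eqP => c0.
have [x [y xy]] : exists x y : G, adj x y.
  have /card_gt1P[x [y [_ _ xy]]] := cardG.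
  have /connectP[[|z p] /=] := cG x y.
    by move=> _ yx; rewrite yx eqxx in xy.
  by case/andP => xz _ _; exists x, z.
have := cP (fun z => if z == x then a else b); rewrite -c0 mul0r leNgt.
move/negP; apply.
have yx : adj y x by rewrite adj_sym.
have tw : 0 < total_weight.
  rewrite /total_weight (bigD1 x)//= ltr_wpDr ?(vweight_gt0 xy)//.
  by apply: sumr_ge0 => z _; exact: vweight_ge0.
rewrite mulr_gt0 ?invr_gt0//.
have t0 (f : G -> X) z t :
    0 <= vweight z * vweight t * mdist (f z) (f t) ^+ 2.
  by apply: mulr_ge0; [exact: mulr_ge0 (vweight_ge0 _) (vweight_ge0 _) | exact: sqr_ge0].
pose f z := if z == x then a else b.
rewrite (bigD1 x)//=; apply: ltr_wpDr.
  by apply: sumr_ge0 => z _; apply: sumr_ge0 => t _; exact: (t0 f).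
rewrite (bigD1 y)//=; apply: ltr_wpDr.
  by apply: sumr_ge0 => t _; exact: (t0 f).
have -> : (y == x) = false.
  by apply/eqP => e; move: xy; rewrite e adj_irr.
rewrite eqxx; apply: mulr_gt0.
  by rewrite mulr_gt0 ?(vweight_gt0 xy) ?(vweight_gt0 yx).
by rewrite exprn_gt0// mdist_gt0; apply/eqP.
Qed.

End SpectralGap.

(* Main.v *)
(** Glue all the graphs G_n into one infinite connected graph by joining a base
    point of G_n to a base point of G_(n+1), and let X be its vertex set with the
    graph distance. Degrees in the glued graph are at most d + 2, so balls grow
    at most exponentially; hence, for the inclusion of G_n into X, at least half
    of the vertices lie at distance of order log |V_n| from any given vertex,
    whereas edges have length at most 1. Testing the Poincare inequality on this
    inclusion gives the bound. *)
Require Import Defs.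
From HB Require Import structures.
From mathcomp Require Import all_boot all_order all_algebra.
From mathcomp Require Import all_classical all_reals all_analysis.
From mathcomp Require Import zify ring.
Import Order.TTheory GRing.Theory Num.Theory.

Set Implicit Arguments.
Unset Strict Implicit.
Unset Printing Implicit Defensive.

Local Open Scope classical_set_scope.
Local Open Scope ring_scope.

(** * Balls and the path metric of a locally finite graph *)

Section GraphBall.
Variables (T : choiceType) (nbr : T -> seq T).

(** Endpoints of walks of exactly [k] steps, listed with repetitions. With closed neighbourhoods a
    walk may stand still, so this is the ball of radius [k]; keeping repetitions makes its size easy
    to bound. *)
Fixpoint gball (k : nat) (x : T) : seq T :=
  if k is k'.+1 then flatten [seq nbr z | z <- gball k' x] else [:: x].

Lemma gballSP k x y :
  reflect (exists2 z, z \in gball k x & y \in nbr z) (y \in gball k.+1 x).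
Proof. exact: flatten_mapP. Qed.

Lemma gball1 x y : (y \in gball 1 x) = (y \in nbr x).
Proof. by rewrite /= cats0. Qed.

Lemma gball_trans j k x y z :
  y \in gball j x -> z \in gball k y -> z \in gball (j + k) x.
Proof.
move=> xy; elim: k z => [|k IH] z.
  by rewrite inE addn0 => /eqP ->.
by case/gballSP => t yt tz; rewrite addnS; apply/gballSP; exists t; rewrite ?IH.
Qed.

Lemma size_gball D k x :
  (forall z, size (nbr z) <= D)%N -> (size (gball k x) <= D ^ k)%N.
Proof.
move=> nbrD; elim: k => [//|k IH] /=; rewrite expnS mulnC.
apply: leq_trans (leq_mul IH (leqnn D)).
elim: (gball k x) => [//|z s IHs] /=.
by rewrite size_cat mulSn leq_add.
Qed.

Hypothesis nbr_sym : forall x y, y \in nbr x -> x \in nbr y.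
Hypothesis nbr_refl : forall x, x \in nbr x.

Lemma gball_sym k x y : y \in gball k x -> x \in gball k y.
Proof.
elim: k y => [|k IH] y; first by rewrite !inE eq_sym.
case/gballSP => z xz zy; rewrite -add1n.
by apply: gball_trans (IH _ xz); rewrite gball1; exact: nbr_sym.
Qed.

Lemma gball_le j k x y : (j <= k)%N -> y \in gball j x -> y \in gball k x.
Proof.
move=> /subnK <- xy; elim: (k - j)%N => [//|i IH].
by rewrite addSn; apply/gballSP; exists y.
Qed.

End GraphBall.

(* Neighbourhoods are closed, i.e. contain their center. *)
Record lfgraph := LFGraph {
  lfvert :> choiceType;
  nbr : lfvert -> seq lfvert;
  nbr_sym : forall x y, y \in nbr x -> x \in nbr y;
  nbr_refl : forall x, x \in nbr x;
  nbr_connected : forall x y, exists k, y \in gball nbr k x }.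

Section GraphDistance.
Variable L : lfgraph.

Definition gdist (x y : L) : nat := ex_minn (nbr_connected x y).

(** Reflexivity of [nbr] makes the balls increase with the radius, so the least radius reaching [y]
    decides membership for every [k]. *)
Lemma gdist_leE k (x y : L) : (gdist x y <= k)%N = (y \in gball (@nbr L) k x).
Proof.
rewrite /gdist; case: ex_minnP => m mP mmin.
apply/idP/idP => [/gball_le|/mmin //]; apply => //; exact: nbr_refl.
Qed.

Lemma gdistxx (x : L) : gdist x x = 0%N.
Proof. by apply/eqP; rewrite -leqn0 gdist_leE inE. Qed.

Lemma gdist_eq0 (x y : L) : gdist x y = 0%N -> x = y.
Proof. by move/eqP; rewrite -leqn0 gdist_leE inE => /eqP. Qed.

Lemma gdist_sym (x y : L) : gdist x y = gdist y x.
Proof.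
have h (u v : L) : (gdist u v <= gdist v u)%N.
  by rewrite gdist_leE gball_sym -?gdist_leE//; exact: nbr_sym.
by apply/eqP; rewrite eqn_leq !h.
Qed.

Lemma gdist_triangle (y x z : L) : (gdist x z <= gdist x y + gdist y z)%N.
Proof. by rewrite gdist_leE (@gball_trans _ _ _ _ _ y) -?gdist_leE. Qed.

End GraphDistance.

(** An alias that records [R], so that a metric structure with values in [R] can be attached to the
    vertices. *)
Definition graph_metric (R : realType) (L : lfgraph) : Type := L.

Section GraphMetric.
Variables (R : realType) (L : lfgraph).

Let dist (x y : graph_metric R L) : R := (gdist (x : L) y)%:R.

Let distxx x : dist x x = 0.
Proof. by rewrite /dist gdistxx. Qed.

Let dist_eq0 x y : dist x y = 0 -> x = y.
Proof. by move/eqP; rewrite pnatr_eq0 => /eqP/gdist_eq0. Qed.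

Let dist_sym x y : dist x y = dist y x.
Proof. by rewrite /dist gdist_sym. Qed.

Let dist_triangle y x z : dist x z <= dist x y + dist y z.
Proof. by rewrite /dist -natrD ler_nat gdist_triangle. Qed.

HB.instance Definition _ := Choice.copy (graph_metric R L) (lfvert L).
HB.instance Definition _ := @isMetric.Build R (graph_metric R L)
  dist distxx dist_eq0 dist_sym dist_triangle.

Lemma mdist_graphE (x y : graph_metric R L) :
  mdist x y = (gdist (x : L) y)%:R :> R.
Proof. by []. Qed.

End GraphMetric.

(** * The chain of graphs glued at base points *)

Section Glue.
Variables (G : nat -> sgraph) (b : forall n, G n).
Hypothesis Gconn : forall n, connected_graph (G n).

Local Notation T := {n : nat & G n}.

Definition glue_vert n (x : G n) : T := Tagged (fun n => vert (G n)) x.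

Local Notation base n := (glue_vert (b n)).

(* The truncated predecessor [0.-1 = 0] only adds a redundant copy of [base 0]. *)
Definition glue_nbr (u : T) : seq T :=
  u :: [seq glue_vert y | y <- enum (adj (tagged u))] ++
  (if u == base (tag u) then [:: base (tag u).+1; base (tag u).-1] else [::]).

Lemma glue_vert_inj n : injective (@glue_vert n).
Proof. by move=> x y /eqP; rewrite /glue_vert eq_Tagged => /eqP. Qed.

Lemma glue_adj n (x y : G n) : adj x y -> glue_vert y \in glue_nbr (glue_vert x).
Proof.
move=> xy; rewrite in_cons mem_cat map_f ?orbT//.
by rewrite mem_enum.
Qed.

Lemma glue_baseS n : base n.+1 \in glue_nbr (base n).
Proof. by rewrite in_cons mem_cat eqxx !inE eqxx !orbT. Qed.

Lemma glue_basep n : base n.-1 \in glue_nbr (base n).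
Proof. by rewrite in_cons mem_cat eqxx !inE eqxx !orbT. Qed.

Lemma glue_nbr_refl u : u \in glue_nbr u.
Proof. exact: mem_head. Qed.

Lemma glue_nbr_sym u v : v \in glue_nbr u -> u \in glue_nbr v.
Proof.
rewrite in_cons mem_cat => /or3P[/eqP ->||].
- exact: glue_nbr_refl.
- case: u => n x /mapP[y]; rewrite mem_enum => xy ->.
  by apply: glue_adj; rewrite adj_sym.
- case: eqP => // ->; rewrite !inE => /orP[] /eqP -> /=.
    exact: (glue_basep (tag u).+1).
  case: (tag u) => [|n]; first exact: glue_nbr_refl.
  exact: glue_baseS.
Qed.

(** The point itself, at most [d] neighbours in its own graph, and at most two links between base
    points. *)
Lemma size_glue_nbr d u :
  (forall n (x : G n), deg x <= d)%N -> (size (glue_nbr u) <= d.+3)%N.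
Proof.
move=> degd; rewrite /= size_cat size_map -cardE.
have : (#|adj (tagged u)| <= d)%N by exact: degd.
by case: ifP => _ /=; lia.
Qed.

(** Every vertex is reached from [base 0]: follow the chain of base points to the right copy, then a
    path inside it. *)
Lemma glue_connected u v : exists k, v \in gball glue_nbr k u.
Proof.
pose conn u v := exists k, v \in gball glue_nbr k u.
have csym x y : conn x y -> conn y x.
  by move=> [k xy]; exists k; apply: gball_sym => //; exact: glue_nbr_sym.
have ctrans y x z : conn x y -> conn y z -> conn x z.
  by move=> [j xy] [k yz]; exists (j + k)%N; exact: gball_trans yz.
have c1 x y : y \in glue_nbr x -> conn x y.
  by move=> xy; exists 1%N; rewrite gball1.
have cG n (x y : G n) : conn (glue_vert x) (glue_vert y).
  have /connectP[p] := Gconn x y; elim: p x => [|z p IH] x /=.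
    by move=> _ ->; exists 0%N; rewrite mem_head.
  case/andP => /glue_adj/c1 xz zp yE; exact: ctrans xz (IH _ zp yE).
have c0 n : conn (base 0) (base n).
  elim: n => [//|n IH]; apply: ctrans IH _; apply: c1; exact: glue_baseS.
have c0u w : conn (base 0) w.
  by case: w => n x; apply: ctrans (c0 n) _; exact: (cG n).
exact: ctrans (csym _ _ (c0u u)) (c0u v).
Qed.

Definition glue : lfgraph :=
  LFGraph glue_nbr_sym glue_nbr_refl glue_connected.

End Glue.

(** * Bounding the spectral gap by a test map with short edges and many distant pairs *)

Lemma vweight_uniform (R : realType) (G : sgraph) (x : G) :
  vweight (uniform_weight R G) x = (deg x)%:R.
Proof.
by rewrite /vweight /= /Defs.uniform_fun -big_mkcond /= sumr_const /deg.
Qed.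

Lemma connected_deg_gt0 (G : sgraph) (x : G) :
  connected_graph G -> (1 < #|G|)%N -> (0 < deg x)%N.
Proof.
move=> cG /card_gt1P[y [z [_ _ yz]]].
have [w xw] : exists w, w != x.
  by have [xy|] := eqVneq y x; [exists z; rewrite -xy eq_sym | exists y].
have /connectP[[|t p] /=] := cG x w; first by move=> _ wx; rewrite wx eqxx in xw.
by case/andP => xt _ _; apply/card_gt0P; exists t.
Qed.

Section GapBound.
Variables (R : realType) (G : sgraph) (X : metricType R) (f : G -> X).
Variables (d : nat) (r : R).
Hypothesis cG : connected_graph G.
Hypothesis G_gt1 : (1 < #|G|)%N.
Hypothesis deg_le : forall x : G, (deg x <= d)%N.
Hypothesis r_gt0 : 0 < r.
Hypothesis f_edge : forall x y : G, adj x y -> mdist (f x) (f y) <= 1.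
Hypothesis f_far :
  forall x : G, (#|G| <= 2 * #|[pred y | (r <= mdist (f x) (f y))%R]|)%N.

Let m := uniform_weight R G.
Let N : R := #|G|%:R.

Let N_gt0 : 0 < N.
Proof. by rewrite ltr0n ltnW. Qed.

Lemma energy_uniform_le : energy m f <= d%:R * N.
Proof.
rewrite /energy (@le_trans _ _ (\sum_(x : G) d%:R))//; last first.
  by rewrite sumr_const -[leLHS]mulr_natr.
apply: ler_sum => x _; apply: (@le_trans _ _ (vweight m x)).
  apply: ler_sum => y _; rewrite /m /= /Defs.uniform_fun; case: ifP => [xy|]; last first.
    by rewrite mul0r.
  by rewrite mul1r expr_le1// ?f_edge// mdist_ge0.
by rewrite vweight_uniform ler_nat.
Qed.

Lemma total_uniform_le : total_weight m <= d%:R * N.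
Proof.
rewrite /total_weight (@le_trans _ _ (\sum_(x : G) d%:R))//; last first.
  by rewrite sumr_const -[leLHS]mulr_natr.
by apply: ler_sum => x _; rewrite vweight_uniform ler_nat.
Qed.

(** Only the far vertices are kept: they are at least half of all, and each weight is a positive
    degree, hence at least 1. *)
Lemma sqdist_row_ge (x : G) :
  N / 2 * r ^+ 2 <= \sum_(y : G) vweight m x * vweight m y * mdist (f x) (f y) ^+ 2.
Proof.
pose far := [pred y | r <= mdist (f x) (f y)].
apply: (@le_trans _ _ (\sum_(y in far) r ^+ 2)).
  rewrite sumr_const -[leRHS]mulr_natl ler_wpM2r ?sqr_ge0// ler_pdivrMr//.
  by rewrite -natrM ler_nat mulnC f_far.
rewrite big_mkcond; apply: ler_sum => y _.
have vx : 1 <= vweight m x by rewrite vweight_uniform ler1n connected_deg_gt0.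
have vy : 1 <= vweight m y by rewrite vweight_uniform ler1n connected_deg_gt0.
case: ifP => [ry|_]; last by rewrite !mulr_ge0 ?vweight_ge0 ?mdist_ge0.
rewrite -[leLHS]mul1r ler_pM ?sqr_ge0//.
  by rewrite -[leLHS]mul1r ler_pM.
by rewrite lerXn2r ?nnegrE ?(le_trans (ltW r_gt0)).
Qed.

(** Testing the optimal Poincare constant [c] on [f] gives
    [N ^+ 2 * r ^+ 2 / 2 <= c * (d * N) ^+ 2]; [N] cancels and inverting bounds the gap. *)
Lemma spectral_gap_uniform_le :
  spectral_gap m X <= 2 * d%:R ^+ 2 / r ^+ 2.
Proof.
have [x [y [_ _ xy]]] := card_gt1P G_gt1.
have d_gt0 : 0 < d%:R :> R.
  by rewrite ltr0n; apply: leq_trans (deg_le x); exact: connected_deg_gt0.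
(* Some vertex is far from [x]; as [r > 0], its image differs from [f x]. *)
have nX : exists a b : X, a <> b.
  have /card_gt0P[z xz] : (0 < #|[pred y | (r <= mdist (f x) (f y))%R]|)%N.
    by move: (f_far x) G_gt1; lia.
  exists (f x), (f z) => xzE; move: xz; rewrite inE xzE mdistxx.
  by rewrite leNgt r_gt0.
have [c_gt0 cP _] := poincare_const_min m cG G_gt1 nX.
rewrite /spectral_gap; set c := poincare_const m X in c_gt0 cP *.
have t_gt0 : 0 < total_weight m.
  rewrite /total_weight (bigD1 x)//= ltr_wpDr//.
    by apply: sumr_ge0 => z _; exact: vweight_ge0.
  by rewrite vweight_uniform ltr0n connected_deg_gt0.
(* Multiplying by the total weight, which is at most [d * N], clears the normalisation; the rows are
   then summed. *)
have mean_ge : N * (N / 2 * r ^+ 2) <= mean_sqdist m f * (d%:R * N).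
  apply: (@le_trans _ _ (mean_sqdist m f * total_weight m)).
    rewrite /mean_sqdist [leRHS]mulrAC mulVf ?gt_eqF// mul1r.
    apply: (@le_trans _ _ (\sum_(z : G) N / 2 * r ^+ 2)).
      by rewrite sumr_const -[leRHS]mulr_natl.
    by apply: ler_sum => z _; exact: sqdist_row_ge.
  rewrite ler_wpM2l ?total_uniform_le// mulr_ge0 ?invr_ge0 ?(ltW t_gt0)//.
  apply: sumr_ge0 => z _; apply: sumr_ge0 => t _.
  by rewrite !mulr_ge0 ?vweight_ge0 ?mdist_ge0.
have : N * (N / 2 * r ^+ 2) <= c * (d%:R * N) * (d%:R * N).
  have dN_ge0 : 0 <= d%:R * N by rewrite mulr_ge0.
  apply: (le_trans mean_ge); rewrite ler_wpM2r//.
  apply: (le_trans (cP f)); rewrite ler_wpM2l ?(ltW c_gt0)//.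
  exact: energy_uniform_le.
have -> : N * (N / 2 * r ^+ 2) = N ^+ 2 * (r ^+ 2 / 2).
  by ring.
have -> : c * (d%:R * N) * (d%:R * N) = N ^+ 2 * (c * d%:R ^+ 2).
  by ring.
rewrite ler_pM2l ?exprn_gt0// => cr.
rewrite -(invrK (2 * _ / _)) lef_pV2 ?posrE ?invr_gt0 ?divr_gt0 ?mulr_gt0 ?exprn_gt0//.
by rewrite invf_div invfM mulrA ler_pdivrMr ?exprn_gt0.
Qed.

End GapBound.

(** * Counting vertices in balls, and the conclusion *)

Lemma card_preim_le (A : finType) (B : eqType) (f : A -> B) (s : seq B) :
  injective f -> (#|[pred y | f y \in s]| <= size s)%N.
Proof.
move=> finj; rewrite cardE -(size_map f); apply: uniq_leq_size.
  by rewrite map_inj_uniq ?enum_uniq.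
by move=> z /mapP[y]; rewrite mem_enum inE => ? ->.
Qed.

Theorem proposition1p2 (R : realType) (d : nat) (d_gt0 : (0 < d)%N) :
  exists Cd : R, 0 < Cd /\
    forall G : nat -> sgraph,
      (forall n, connected_graph (G n)) ->
      (forall n, (1 < #|G n|)%N) ->
      (fun n => #|G n|) @ \oo --> \oo ->
      (forall n (v : G n), (deg v <= d)%N) ->
      exists X : metricType R,
        (exists a b : X, a <> b) /\
        forall n, spectral_gap (uniform_weight R (G n)) X
                  <= Cd / ln (#|G n|%:R) ^+ 2.
Proof.
pose D := d.+3; pose l : R := ln D%:R.
have l_gt0 : 0 < l by rewrite ln_gt0// ltr1n.
(* [2 * d ^+ 2] comes from the gap bound at radius [k.+1], and [(2 * l) ^+ 2] from comparing [k.+1]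
   with [ln N]. *)
exists (2 * d%:R ^+ 2 * (2 * l) ^+ 2); split.
  by rewrite !mulr_gt0 ?exprn_gt0 ?mulr_gt0 ?ltr0n.
move=> G Gconn G_gt1 _ Gdeg.
have b n : G n by apply: (@enum_val (G n) predT); exact: Ordinal (ltnW (G_gt1 n)).
pose L := glue b Gconn; exists (graph_metric R L).
pose f n (x : G n) : graph_metric R L := glue_vert x.
split.
  exists (f 0%N (b 0%N)), (f 1%N (b 1%N)) => /(congr1 (fun u : L => tag u)).
  by [].
(* [k] is the largest radius for which the growth bound [D ^ k] stays within half of the
   vertices. *)
move=> n; set N := #|G n|; set k := trunc_log D (N %/ 2).
have N_gt1 : (1 < N)%N by exact: G_gt1.
have N2_gt0 : (0 < N %/ 2)%N by rewrite divn_gt0.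
have lN_gt0 : 0 < ln (N%:R : R) by rewrite ln_gt0// ltr1n.
have kN : (2 * D ^ k <= N)%N.
  have : (D ^ k <= N %/ 2)%N by exact: trunc_logP.
  by lia.
have lnN : ln (N%:R : R) <= 2 * l * k.+1%:R.
  (* Maximality of [k] gives [N < 2 * D ^ k.+1], and the factor 2 is absorbed by a second
     [D ^ k.+1]. *)
  have Nk : (N <= D ^ (2 * k.+1))%N.
    have : (N %/ 2 < D ^ k.+1)%N by exact: trunc_log_ltn.
    have : (2 <= D ^ k.+1)%N by rewrite expnS; have := expn_gt0 D k; lia.
    rewrite mulnC expnM; nia.
  rewrite mulrAC -natrM mulrC mulr_natr -lnXn ?ltr0n// -natrX.
  by rewrite ler_ln ?posrE ?ltr0n ?expn_gt0 ?(ltnW N_gt1)// ler_nat.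
apply: (@le_trans _ _ (2 * d%:R ^+ 2 / k.+1%:R ^+ 2)).
  apply: (@spectral_gap_uniform_le R (G n) _ (f n)) => //.
  - move=> x y xy; rewrite mdist_graphE lern1 gdist_leE gball1.
    exact: glue_adj.
  - move=> x.
    (* Distances are integers, so being at distance at least [k.+1] means lying outside the ball of
       radius [k]. *)
    pose near := [pred y : G n | glue_vert y \in gball (@nbr L) k (glue_vert x)].
    have -> : #|[pred y | (k.+1%:R <= mdist (f n x) (f n y) :> R)%R]| = #|predC near|.
      apply: eq_card => y; rewrite [LHS]inE [RHS]inE.
      by rewrite [LHS]ler_nat ltnNge gdist_leE.
    have nearD : (#|near| <= D ^ k)%N.
      apply: leq_trans (card_preim_le _ (@glue_vert_inj G n)) _.
      by apply: size_gball => u; exact: size_glue_nbr.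
    (* Half of the vertices are far exactly when [2 * #|near| <= N], which follows from
       [#|near| <= D ^ k]. *)
    rewrite -(cardC near) mul2n -addnn leq_add2r.
    rewrite -(leq_add2l #|near|) cardC addnn -mul2n.
    by apply: leq_trans kN; rewrite leq_mul2l.
rewrite -[leRHS]mulrA ler_wpM2l ?mulr_ge0 ?sqr_ge0//.
rewrite ler_pdivlMr ?exprn_gt0// ler_pdivrMl ?exprn_gt0 ?ltr0n//.
by rewrite [leRHS]mulrC -exprMn lerXn2r// nnegrE ?(ltW lN_gt0)//
  !mulr_ge0// (ltW l_gt0).
Qed.
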